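(* Let $n\ge 4$ be even. (i) Every tiling of the first quadrant $Q_1=[0,\infty)^2$ by $\mathcal{T}_n^+$, and every tiling of $Q_1$ by $\mathcal{T}_n$, follows the rectangular pattern. (ii) Let $R$ be an $a\times b$ rectangle with $a,b$ positive integers, at least one of which is odd (i.e. $R$ is even$\times$odd, odd$\times$even or odd$\times$odd). Then there exists a tiling of $Q_1$ by $\mathcal{T}_n^+\cup\{R\}$ that does not follow the rectangular pattern, and there exists a tiling of $Q_1$ by $\mathcal{T}_n\cup\{R\}$ that does not follow the rectangular pattern.
   Context: A cell is a unit square $[i,i+1]\times[j,j+1]$ with $i,j\in\mathbb{Z}$; write $(i,j)$ for it. Define the following polyominoes (sets of cells, considered up to translation by integer vectors): $T_1=\{(0,j):0\le j\le n-2\}\cup\{(1,0)\}$; $T_2=\{(1,j):0\le j\le n-2\}\cup\{(0,n-2)\}$; $T_3=\{(i,0):0\le i\le n-2\}\cup\{(0,1)\}$; $T_4=\{(i,1):0\le i\le n-2\}\cup\{(n-2,0)\}$; $T_5=\{(0,0),(1,0),(0,1),(1,1)\}$ (a $2\times 2$ square). $T_1,\dots,T_4$ are the ribbon $L$-shaped $n$-ominoes. Let $\mathcal{T}_n=\{T_1,T_2,T_3,T_4\}$ and $\mathcal{T}_n^+=\{T_1,\dots,T_5\}$. A tiling of a region by a set of tiles is a covering of the region by translates by integer vectors (no rotations or reflections) of tiles from the set, with pairwise disjoint interiors. An $a\times b$ rectangle has height $a$ and base $b$. A rectangle is called even if all coordinates of its vertices are even. A tiling follows the rectangular pattern on a region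 $P$ if $P$ is the union of non-overlapping even rectangles each of which is either a $2\times 2$ square that is a single $T_5$ tile of the tiling, or a $2\times n$ or $n\times 2$ rectangle that is exactly the union of two ribbon $L$-shaped $n$-omino tiles of the tiling. A tiling of $Q_1$ follows the rectangular pattern if $Q_1$ itself follows it, i.e. the tiling reduces to a tiling by such $2\times2$, $2\times n$, $n\times 2$ rectangles. *)

(* Defs.v *)
From HB Require Import structures.
From mathcomp Require Import all_boot all_order all_algebra.
From mathcomp Require Import boolp classical_sets.

Set Implicit Arguments.
Unset Strict Implicit.
Unset Printing Implicit Defensive.

Import Order.TTheory GRing.Theory Num.Theory.

Local Open Scope classical_set_scope.
Local Open Scope ring_scope.

(* (i, j) stands for the unit square [i, i+1] x [j, j+1].  Regions and tiles
   are unions of cells, hence sets of cells; such unions have disjoint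
   interiors exactly when they have no cell in common. *)
Definition cell : Type := (int * int)%type.

Definition translate (v : cell) (A : set cell) : set cell :=
  [set c + v | c in A].

Definition T1 (n : nat) : set cell :=
  [set c | c.1 = 0 /\ 0 <= c.2 <= n%:Z - 2] `|` [set (1, 0)].
Definition T2 (n : nat) : set cell :=
  [set c | c.1 = 1 /\ 0 <= c.2 <= n%:Z - 2] `|` [set (0, n%:Z - 2)].
Definition T3 (n : nat) : set cell :=
  [set c | c.2 = 0 /\ 0 <= c.1 <= n%:Z - 2] `|` [set (0, 1)].
Definition T4 (n : nat) : set cell :=
  [set c | c.2 = 1 /\ 0 <= c.1 <= n%:Z - 2] `|` [set (n%:Z - 2, 0)].
Definition T5 : set cell :=
  [set ((0, 0) : cell); (1, 0); (0, 1); (1, 1)].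

Definition ribbonL (n : nat) : set (set cell) :=
  [set T1 n; T2 n; T3 n; T4 n].
Definition ribbonL_plus (n : nat) : set (set cell) :=
  ribbonL n `|` [set T5].

Definition Q1 : set cell := [set c | 0 <= c.1 /\ 0 <= c.2].

(* The rectangle with lower left vertex (x, y), height a and base b. *)
Definition rectangle (x y : int) (a b : nat) : set cell :=
  [set c | x <= c.1 < x + b%:Z /\ y <= c.2 < y + a%:Z].

Definition even_vertices (x y : int) (a b : nat) : Prop :=
  [/\ (2 %| x)%Z, (2 %| y)%Z, (2 %| x + b%:Z)%Z & (2 %| y + a%:Z)%Z].

Definition translate_from (S : set (set cell)) (A : set cell) : Prop :=
  exists T v, S T /\ A = translate v T.

(* A tiling is the set of its (placed) tiles. *)
Definition tiling (P : set cell) (S tau : set (set cell)) : Prop :=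
  (forall A, tau A -> translate_from S A) /\
  classical_sets.partition tau id P.

Definition single_square (tau : set (set cell)) (D : set cell) : Prop :=
  tau D /\ translate_from [set T5] D.

Definition two_ribbonL (n : nat) (tau : set (set cell)) (D : set cell) : Prop :=
  exists A B, [/\ tau A /\ translate_from (ribbonL n) A,
                  tau B /\ translate_from (ribbonL n) B,
                  A <> B & D = A `|` B].

Definition pattern_rectangle (n : nat) (tau : set (set cell)) (D : set cell)
    : Prop :=
  exists x y a b,
    [/\ D = rectangle x y a b, even_vertices x y a b &
        (a = 2%N /\ b = 2%N /\ single_square tau D) \/
        (((a = 2%N /\ b = n) \/ (a = n /\ b = 2%N)) /\ two_ribbonL n tau D)].

Definition follows_rectangular_pattern (n : nat) (tau : set (set cell))
    (P : set cell) : Prop :=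
  exists F : set (set cell),
    (forall D, F D -> pattern_rectangle n tau D) /\
    classical_sets.partition F id P.

(* Main.v *)
Require Import Defs.
From mathcomp Require Import all_boot all_order all_algebra.
From mathcomp Require Import boolp classical_sets.
From mathcomp Require Import zify.

Local Open Scope classical_set_scope.
Local Open Scope ring_scope.

(** Cut the quadrant into the 2x2 blocks with even corners and call a block good
    when it lies in a pattern rectangle.  A tile meeting a good block stays inside
    good blocks, so at a bad block all of whose lower-left blocks are good the tile
    covering the corner cell is nearly forced.  It is of one of two types: either
    it forces a tile to stick out downwards further to the right, or, by
    reflection in the diagonal, it forces a tile to stick out leftwards further
    up.  Among the minimal bad blocks, ordered along their staircase, the lowest
    one cannot be of the first type nor the leftmost one of the second type, so
    two consecutive ones head towards each other; their forced tiles then compete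
    for the single cell at the inner corner of the staircase.
    An odd rectangle alone tiles the quadrant as a grid, without any other tile. *)

(** * Placed tiles in integer coordinates, good blocks, reflection in the diagonal *)

Inductive kind := K1 | K2 | K3 | K4 | K5.

(* The copy of T_k with offset (x, y) contains the cell (u, v); here n = 2 m. *)
Definition hits (m : int) (k : kind) (x y u v : int) : Prop :=
  match k with
  | K1 => (u = x /\ y <= v <= y + 2 * m - 2) \/ (u = x + 1 /\ v = y)
  | K2 => (u = x + 1 /\ y <= v <= y + 2 * m - 2) \/ (u = x /\ v = y + 2 * m - 2)
  | K3 => (v = y /\ x <= u <= x + 2 * m - 2) \/ (u = x /\ v = y + 1)
  | K4 => (v = y + 1 /\ x <= u <= x + 2 * m - 2) \/ (u = x + 2 * m - 2 /\ v = y)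
  | K5 => x <= u <= x + 1 /\ y <= v <= y + 1
  end.

(** A tiling of the quadrant, with [P k x y] meaning that the copy of T_k at offset (x, y) is a
    tile; geometric steps become linear arithmetic. *)
Record placement (m : int) (P : kind -> int -> int -> Prop) : Prop := Placement {
  pl_ge2 : 2 <= m;
  pl_cover : forall u v, 0 <= u -> 0 <= v ->
    exists k x y, P k x y /\ hits m k x y u v;
  pl_inside : forall k x y u v, P k x y -> hits m k x y u v -> 0 <= u /\ 0 <= v;
  pl_disjoint : forall k x y k' x' y' u v, P k x y -> P k' x' y' ->
    hits m k x y u v -> hits m k' x' y' u v -> [/\ k = k', x = x' & y = y'] }.

(* Block coordinates: (i, j) stands for the four cells of [in_block i j]. *)
Definition good (m : int) (P : kind -> int -> int -> Prop) (i j : int) : Prop :=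
  exists p q,
    [\/ [/\ P K5 (2 * p) (2 * q), i = p & j = q],
        [/\ P K1 (2 * p) (2 * q), P K2 (2 * p) (2 * q + 1), i = p &
            q <= j < q + m] |
        [/\ P K3 (2 * p) (2 * q), P K4 (2 * p + 1) (2 * q), j = q &
            p <= i < p + m]].

Definition in_block (i j u v : int) : Prop :=
  2 * i <= u <= 2 * i + 1 /\ 2 * j <= v <= 2 * j + 1.

Definition flip_kind (k : kind) : kind :=
  match k with K1 => K3 | K2 => K4 | K3 => K1 | K4 => K2 | K5 => K5 end.

Definition flip (P : kind -> int -> int -> Prop) : kind -> int -> int -> Prop :=
  fun k x y => P (flip_kind k) y x.

Lemma flip_kindK : involutive flip_kind.
Proof. by case. Qed.

Lemma hits_flip m k x y u v :
  hits m (flip_kind k) y x v u <-> hits m k x y u v.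
Proof. by case: k => /=; lia. Qed.

Lemma placement_flip m P : placement m P -> placement m (flip P).
Proof.
move=> T; split; first exact: pl_ge2 T.
- move=> u v u0 v0; have [k [x [y [H h]]]] := pl_cover _ _ T _ _ v0 u0.
  exists (flip_kind k), y, x; rewrite /flip flip_kindK; split=> //.
  exact/hits_flip.
- move=> k x y u v H /hits_flip h.
  by have [] := pl_inside _ _ T _ _ _ _ _ H h.
move=> k x y k' x' y' u v H H' /hits_flip h /hits_flip h'.
have [e -> ->] := pl_disjoint _ _ T _ _ _ _ _ _ _ _ H H' h h'.
by rewrite -(flip_kindK k) e flip_kindK.
Qed.

Lemma good_flip m P i j : good m P i j -> good m (flip P) j i.
Proof.
move=> [p [q [[H -> ->]|[H1 H2 e b]|[H1 H2 e b]]]]; exists q, p.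
- by constructor 1.
- by constructor 3.
- by constructor 2.
Qed.

(** Refutes two distinct tiles by a common cell [(u, v)]. *)
Ltac collide T H H' u v :=
  exfalso;
  have := pl_disjoint _ _ T _ _ _ _ _ _ u v H H'
    ltac:(rewrite /=; lia) ltac:(rewrite /=; lia);
  case=> // *; lia.

(** By disjointness the tile is one of those making up the pattern rectangle around the good block,
    and that rectangle is a union of good blocks. *)
Lemma good_tile m P (T : placement m P) k x y u v u' v' i j i' j' :
  P k x y -> hits m k x y u v -> hits m k x y u' v' ->
  in_block i j u v -> in_block i' j' u' v' -> good m P i j -> good m P i' j'.
Proof.
rewrite /in_block => H h h' b b' [p [q c]]; exists p, q.
have D := pl_disjoint _ _ T _ _ _ _ _ _ u v H.
case: c => [[H5 e1 e2]|[H1 H2 e1 e2]|[H3 H4 e1 e2]].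
- have [|ek ex ey] := D _ _ _ H5 h; first by rewrite /=; lia.
  by constructor 1; move: h'; rewrite ek ex ey /= => h'; split=> //; lia.
- constructor 2; have [h1|h1] : hits m K1 (2 * p) (2 * q) u v \/
    hits m K2 (2 * p) (2 * q + 1) u v by rewrite /=; lia.
  + have [ek ex ey] := D _ _ _ H1 h h1.
    by move: h'; rewrite ek ex ey /= => h'; split=> //; lia.
  + have [ek ex ey] := D _ _ _ H2 h h1.
    by move: h'; rewrite ek ex ey /= => h'; split=> //; lia.
- constructor 3; have [h1|h1] : hits m K3 (2 * p) (2 * q) u v \/
    hits m K4 (2 * p + 1) (2 * q) u v by rewrite /=; lia.
  + have [ek ex ey] := D _ _ _ H3 h h1.
    by move: h'; rewrite ek ex ey /= => h'; split=> //; lia.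
  + have [ek ex ey] := D _ _ _ H4 h h1.
    by move: h'; rewrite ek ex ey /= => h'; split=> //; lia.
Qed.

(** Contrapositive of [good_tile]: badness spreads along a tile. *)
Lemma bad_tile m P (T : placement m P) k x y u v i j :
  P k x y -> hits m k x y u v -> in_block i j u v -> ~ good m P i j ->
  forall u' v' i' j', hits m k x y u' v' -> in_block i' j' u' v' ->
    [/\ 0 <= i', 0 <= j' & ~ good m P i' j'].
Proof.
move=> H h b B u' v' i' j' h' b'.
have [u0 v0] := pl_inside _ _ T _ _ _ _ _ H h'.
split; [by case: b'; lia | by case: b'; lia |].
move=> g; apply: B.
exact: good_tile T _ _ _ _ _ _ _ _ _ _ _ H h' h b' b g.
Qed.

(** * Corners of the bad region and the tiles they force *)

Definition corner m P (i j : int) : Prop :=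
  [/\ 0 <= i, 0 <= j, ~ good m P i j &
      forall i' j' : int, 0 <= i' <= i -> 0 <= j' <= j -> i' < i \/ j' < j ->
        good m P i' j'].

Definition heads_down (P : kind -> int -> int -> Prop) (i j : int) : Prop :=
  P K1 (2 * i) (2 * j) \/ P K4 (2 * i) (2 * j - 1).

(** Convertible to [heads_down (flip P) j i], so that [heads_down_config] applies to it. *)
Definition heads_left (P : kind -> int -> int -> Prop) (i j : int) : Prop :=
  P K3 (2 * i) (2 * j) \/ P K2 (2 * i - 1) (2 * j).

Lemma corner_flip m P i j : corner m P i j -> corner m (flip P) j i.
Proof.
move=> [i0 j0 B G]; split=> //; first by move/good_flip; apply: B.
by move=> j' i' hj hi c; apply: good_flip; apply: G => //; case: c; auto.
Qed.

(** The tile on the lower left cell of the block meets bad blocks only, so it avoids all blocks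
    weakly to the lower left; a [K5] tile would make the block good. *)
Lemma corner_heads m P (T : placement m P) i j :
  corner m P i j -> heads_down P i j \/ heads_left P i j.
Proof.
move=> [i0 j0 B G]; have m2 := pl_ge2 _ _ T.
have [k [x [y [H h]]]] := pl_cover _ _ T (2 * i) (2 * j) ltac:(lia) ltac:(lia).
have E u' v' : hits m k x y u' v' -> u' < 2 * i + 2 -> v' < 2 * j + 2 ->
    2 * i <= u' /\ 2 * j <= v'.
  move=> h' u1 v1.
  pose i' := (u' %/ 2)%Z; pose j' := (v' %/ 2)%Z.
  have b' : in_block i' j' u' v' by rewrite /in_block /i' /j'; lia.
  have b : in_block i j (2 * i) (2 * j) by rewrite /in_block; lia.
  have [i'0 j'0 B'] := bad_tile _ _ T _ _ _ _ _ _ _ H h b B _ _ _ _ h' b'.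
  suff : ~ (i' < i \/ j' < j) by move: b'; rewrite /in_block; lia.
  by move=> c; apply: B'; apply: G => //; move: b'; rewrite /in_block; lia.
(* The cells just left of and just below the block rule out all other offsets. *)
have E1 := E (2 * i - 1) (2 * j); have E2 := E (2 * i) (2 * j - 1).
have E3 := E (2 * i - 1) (2 * j + 1); have E4 := E (2 * i + 1) (2 * j - 1).
rewrite /heads_down /heads_left.
case: k H h E E1 E2 E3 E4 => /= H h E E1 E2 E3 E4.
- have ex : x = 2 * i by lia.
  have ey : y = 2 * j by lia.
  by subst; left; left.
- have ex : x = 2 * i - 1 by lia.
  have ey : y = 2 * j by lia.
  by subst; right; right.
- have ex : x = 2 * i by lia.
  have ey : y = 2 * j by lia.
  by subst; right; left.
- have ex : x = 2 * i by lia.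
  have ey : y = 2 * j - 1 by lia.
  by subst; left; right.
- have ex : x = 2 * i by lia.
  have ey : y = 2 * j by lia.
  by subst; case: B; exists i, j; constructor 1.
Qed.

(* What a corner heading down forces near the cell (2 I, 2 J): a horizontal bar
   across it, or tiles enclosing it from the left and from above, or a vertical
   bar through it. *)
Definition down_config m (P : kind -> int -> int -> Prop) (I J : int) : Prop :=
  [\/ exists2 x, P K4 (2 * x) (2 * J - 1) & x < I <= x + m - 1,
      P K1 (2 * I - 2) (2 * J) /\
      [\/ P K1 (2 * I - 1) (2 * J + 1), P K3 (2 * I - 1) (2 * J + 1),
          P K5 (2 * I - 1) (2 * J + 1) | P K4 (2 * I - 1) (2 * J)] |
      P K1 (2 * I - 2) (2 * J) /\ P K2 (2 * I - 1) (2 * J + 3 - 2 * m)].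

(** A tile of a bad block can dip below row J only from column I on. The bound on I holds because
    the dipping foot is at most m blocks to the right of column i; it gives a contradiction when I
    can be chosen freely. *)
Lemma heads_down_config m P (T : placement m P) i I J :
  corner m P i J -> heads_down P i J -> i < I ->
  (forall i' j' : int, 0 <= i' < I -> 0 <= j' < J -> good m P i' j') ->
  down_config m P I J /\ I <= i + m.
Proof.
move=> [i0 j0 B _] hd iI G; have m2 := pl_ge2 _ _ T.
(* The foot of this [K4] tile lies in block (x + m - 1, J - 1), which is bad, hence not left of
   column I. *)
have leg x : x <= i + 1 -> x < I -> P K4 (2 * x) (2 * J - 1) ->
    ~ good m P x J -> down_config m P I J /\ I <= i + m.
  move=> xi xI H Bx.
  have [] := bad_tile _ _ T _ _ _ (2 * x) (2 * J) _ _ H _ _ Bx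
    (2 * x + 2 * m - 2) (2 * J - 1) (x + m - 1) (J - 1).
  - by rewrite /=; lia.
  - by rewrite /in_block; lia.
  - by rewrite /=; lia.
  - by rewrite /in_block; lia.
  move=> x0 J0 Bl; have Il : I <= x + m - 1.
    have [//|lI] : I <= x + m - 1 \/ x + m - 1 < I by lia.
    by case: Bl; apply: G; lia.
  by split; [constructor 1; exists x => //; lia | lia].
case: hd => [H1|H4]; last by apply: (leg i) => //; lia.
have [k [x [y [H h]]]] :=
  pl_cover _ _ T (2 * i + 1) (2 * J + 1) ltac:(lia) ltac:(lia).
have D u v := pl_disjoint _ _ T _ _ _ _ _ _ u v H H1.
have b : in_block i J (2 * i + 1) (2 * J + 1) by rewrite /in_block; lia.
have E := bad_tile _ _ T _ _ _ _ _ _ _ H h b B.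
(* Candidates for the notch (2i + 1, 2J + 1) of the [K1] tile: the partner completing a pattern
   rectangle, a vertical bar in column 2i + 2 with its foot in the notch, or a tile reaching right
   over (2i + 2, 2J + 1). *)
have cases : [\/ [/\ k = K2, x = 2 * i & y = 2 * J + 1],
    [/\ k = K2, x = 2 * i + 1 & y = 2 * J + 3 - 2 * m] |
    (exists2 y', y = y' & x = 2 * i + 1 /\
      ((k = K4 /\ y' = 2 * J) \/
       (k = K1 \/ k = K3 \/ k = K5) /\ y' = 2 * J + 1))].
  have D1 := D (2 * i) (2 * J + 1); have D2 := D (2 * i + 1) (2 * J).
  have D3 := D (2 * i) (2 * J + 2).
  have F1 : ~ hits m k x y (2 * i) (2 * J + 1).
    move=> h1; have [|ek ex ey] := D1 h1; first by rewrite /=; lia.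
    by move: h; rewrite ek ex ey /=; lia.
  have F2 : ~ hits m k x y (2 * i + 1) (2 * J).
    move=> h1; have [|ek ex ey] := D2 h1; first by rewrite /=; lia.
    by move: h; rewrite ek ex ey /=; lia.
  have F3 : ~ hits m k x y (2 * i) (2 * J + 2).
    move=> h1; have [|ek ex ey] := D3 h1; first by rewrite /=; lia.
    by move: h; rewrite ek ex ey /=; lia.
  case: k {H D E D1 D2 D3} h F1 F2 F3 => /= h F1 F2 F3.
  - constructor 3; exists y => //; split; [|right; split; [by left|]]; lia.
  - have [ex|ex] : x = 2 * i \/ x = 2 * i + 1 by lia.
      by constructor 1; split=> //; lia.
    by constructor 2; split=> //; lia.
  - constructor 3; exists y => //; split; [|right; split; [by right; left|]]; lia.
  - constructor 3; exists y => //; split; [|left; split=> //]; lia.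
  - constructor 3; exists y => //; split; [|right; split; [by right; right|]]; lia.
have [Ii1|i1I] : I <= i + 1 \/ i + 1 < I by lia.
  have eI : I = i + 1 by lia.
  split; last by lia.
  rewrite eI /down_config.
  have -> : 2 * (i + 1) - 2 = 2 * i by lia.
  have -> : 2 * (i + 1) - 1 = 2 * i + 1 by lia.
  case: cases H => [[-> -> ->] H|[-> -> ->] H|[_ <- [-> [[-> ->]|[c ->]]]] H].
  - case: B; exists i, J; constructor 2; split=> //; lia.
  - by constructor 3.
  - by constructor 2; split=> //; constructor 4.
  - constructor 2; split; first by [].
    by case: c H => [->|[->|->]] H; [constructor 1|constructor 2|constructor 3].
have B1 : hits m k x y (2 * i + 2) (2 * J + 1) -> ~ good m P (i + 1) J.
  by move=> h1; case: (E _ _ (i + 1) J h1) => //; rewrite /in_block; lia.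
case: cases => [[ek ex ey]|[ek ex ey]|[y' ey [ex c]]].
- by subst; case: B; exists i, J; constructor 2; split=> //; lia.
(* As m is at least 2, the vertical bar descends into row 2J - 1, inside a good block. *)
- have [||? ?] := E (2 * i + 2) (2 * J - 1) (i + 1) (J - 1).
  + by rewrite ek ex ey /=; lia.
  + by rewrite /in_block; lia.
  by case; apply: G; lia.
have h1 : hits m k x y (2 * i + 2) (2 * J + 1).
  by case: c => [[ek e]|[ek e]]; [|case: ek => [|[|]] ek];
    rewrite ek ex ey e /=; lia.
have hX : ~ hits m k x y (2 * i + 2) (2 * J).
  by case: c => [[ek e]|[ek e]]; [|case: ek => [|[|]] ek];
    rewrite ek ex ey e /=; lia.
move: {B1} (B1 h1) => B1.
(* The cell (2i + 2, 2J) is a pocket: closed on the left by the foot of [K1], above by the notch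
   tile, below by good blocks. Only a [K4] bar starting there fits. *)
have [k2 [x2 [y2 [H2 h2]]]] :=
  pl_cover _ _ T (2 * i + 2) (2 * J) ltac:(lia) ltac:(lia).
have b2 : in_block (i + 1) J (2 * i + 2) (2 * J) by rewrite /in_block; lia.
have E2 := bad_tile _ _ T _ _ _ _ _ _ _ H2 h2 b2 B1.
have F1 : ~ hits m k2 x2 y2 (2 * i + 1) (2 * J).
  move=> h3; have [|e1 e2 e3] := pl_disjoint _ _ T _ _ _ _ _ _ _ _ H2 H1 h3.
    by rewrite /=; lia.
  by move: h2; rewrite e1 e2 e3 /=; lia.
have F2 : ~ hits m k2 x2 y2 (2 * i + 2) (2 * J + 1).
  move=> h3; have [e1 e2 e3] := pl_disjoint _ _ T _ _ _ _ _ _ _ _ H2 H h3 h1.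
  by move: h2; rewrite e1 e2 e3.
have below u : 2 * i + 2 <= u <= 2 * i + 3 -> ~ hits m k2 x2 y2 u (2 * J - 1).
  move=> hu h3; case: (E2 _ _ (i + 1) (J - 1) h3); first by rewrite /in_block; lia.
  by move=> _ ?; case; apply: G; lia.
have F3 := below (2 * i + 2) ltac:(lia).
have F4 := below (2 * i + 3) ltac:(lia).
have [e1 [e2 e3]] : k2 = K4 /\ x2 = 2 * (i + 1) /\ y2 = 2 * J - 1.
  by case: k2 {H2 E2 below} h2 F1 F2 F3 F4 => /= h2 F1 F2 F3 F4;
    (split; [done|lia]) || (exfalso; lia).
by subst; apply: (leg (i + 1)) => //; lia.
Qed.

(** The cell (2I, 2J) is the inner corner of the staircase. In all pairs of configurations but one,
    two forced tiles overlap at or next to it; in the remaining pair it is left isolated. *)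
Lemma down_config_flip m P (T : placement m P) I J : 0 <= I -> 0 <= J ->
  down_config m P I J -> ~ down_config m (flip P) J I.
Proof.
move=> I0 J0; have m2 := pl_ge2 _ _ T.
case=> [[x HD hx]|[HD cD]|[HD HD']];
  case=> [[y HU hy]|[HU cU]|[HU HU']]; rewrite /flip /= in HU *.
- collide T HD HU (2 * I) (2 * J).
(* Either the foot of the bar falls on the foot of the mirrored [K1] tile, or the bar runs on over
   (2I + 1, 2J), held by the mirrored enclosing tile. *)
- have [e|e] : x + m - 1 = I \/ I < x + m - 1 by lia.
    collide T HD HU (2 * I) (2 * J - 1).
  by rewrite /flip /= in cU; case: cU => H; collide T HD H (2 * I + 1) (2 * J).
- rewrite /flip /= in HU'; collide T HD HU' (2 * I) (2 * J).
- have [e|e] : y + m - 1 = J \/ J < y + m - 1 by lia.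
    collide T HD HU (2 * I - 1) (2 * J).
  by case: cD => H; collide T HU H (2 * I) (2 * J + 1).
(* All four neighbours of (2I, 2J) belong to tiles missing that cell, and no tile is a single
   cell. *)
- have [k [x [y [H h]]]] :=
    pl_cover _ _ T (2 * I) (2 * J) ltac:(lia) ltac:(lia).
  have avoid k' x' y' u v : P k' x' y' -> hits m k' x' y' u v ->
      ~ hits m k' x' y' (2 * I) (2 * J) -> ~ hits m k x y u v.
    move=> H' h' n' hk; apply: n'.
    by have [<- <- <-] := pl_disjoint _ _ T _ _ _ _ _ _ _ _ H H' hk h'.
  have F1 : ~ hits m k x y (2 * I - 1) (2 * J).
    by apply: (avoid _ _ _ _ _ HD) => /=; lia.
  have F2 : ~ hits m k x y (2 * I) (2 * J - 1).
    by apply: (avoid _ _ _ _ _ HU) => /=; lia.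
  have F3 : ~ hits m k x y (2 * I) (2 * J + 1).
    by case: cD => H'; apply: (avoid _ _ _ _ _ H') => /=; lia.
  have F4 : ~ hits m k x y (2 * I + 1) (2 * J).
    by case: cU => H'; apply: (avoid _ _ _ _ _ H'); rewrite /=; lia.
  by case: k {H avoid} h F1 F2 F3 F4 => /=; lia.
- rewrite /flip /= in HU'; collide T HD HU' (2 * I - 1) (2 * J).
- collide T HD' HU (2 * I) (2 * J).
- collide T HD' HU (2 * I) (2 * J - 1).
- collide T HD' HU (2 * I) (2 * J - 1).
Qed.

(** * Descent along the staircase of corners *)

Lemma ex_least (Q : nat -> Prop) : (exists k, Q k) ->
  exists2 k, Q k & forall k', (k' < k)%N -> ~ Q k'.
Proof.
move=> [k0 Qk0]; have ex : exists k, `[< Q k >] by exists k0; apply/asboolP.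
case: (ex_minnP ex) => k /asboolP Qk least; exists k => // k' lt /asboolP /least.
by rewrite leqNgt lt.
Qed.

(** Take the lowest row with a bad block in the columns [W], then its leftmost bad block. As [W] is
    closed to the left, this is a corner of the whole bad region. *)
Lemma lowest_corner m P (W : int -> Prop) :
  (forall i i', W i -> i' <= i -> W i') ->
  (exists i j : nat, W i /\ ~ good m P i j) ->
  exists i j : nat, [/\ corner m P i j, W i &
    forall i' j' : int, 0 <= i' -> W i' -> 0 <= j' < j%:Z -> good m P i' j'].
Proof.
move=> Wdown [i0 [j0 b0]].
have [|j [i1 b1] jmin] :=
    ex_least (fun j => exists i : nat, W i /\ ~ good m P i j).
  by exists j0, i0.
have [|i [Wi Bi] imin] := ex_least (fun i => W i%:Z /\ ~ good m P i j).
  by exists i1.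
have G (i' j' : int) : 0 <= i' -> W i' -> 0 <= j' < j%:Z -> good m P i' j'.
  move=> i'0 Wi' hj; apply: contrapT => B'.
  apply: (jmin `|j'|%N); first by lia.
  exists `|i'|%N; have -> : `|i'|%N%:Z = i' by lia.
  by have -> : `|j'|%N%:Z = j' by lia.
exists i, j; split=> //; split=> // i' j' hi hj c.
have Wi' : W i' by apply: Wdown Wi _; lia.
have [lt|e] : j' < j%:Z \/ j' = j%:Z by lia.
  by apply: G => //; lia.
rewrite e; apply: contrapT => B'; apply: (imin `|i'|%N); first by lia.
by have -> : `|i'|%N%:Z = i' by lia.
Qed.

(* The next corner up the staircase must head left as well, as two corners
   heading towards each other clash; its abscissa is smaller than [I]. *)
Lemma heads_left_absurd m P (T : placement m P) (I : nat) (J : int) :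
  corner m P I J -> ~ heads_left P I J.
Proof.
have [n] := ubnP I; elim: n I J => // n IHn I J In cIJ hl.
have m2 := pl_ge2 _ _ T; have [I0 J0 _ GI] := cIJ.
have up (j : int) : J < j ->
    (forall i' j' : int, 0 <= i' < I%:Z -> 0 <= j' < j -> good m P i' j') ->
    down_config m (flip P) j I /\ j <= J + m.
  move=> Jj G; apply: heads_down_config (corner_flip _ _ _ _ cIJ) hl Jj _.
    exact: placement_flip.
  by move=> j' i' hj hi; apply: good_flip; apply: G.
(* The lowest corner left of column I is the next one up: below it, all blocks left of column I are
   good, as both configurations at (I, j) require. *)
have [ex|nex] := pselect (exists i j : nat, i%:Z < I%:Z /\ ~ good m P i j).
  have [i [j [cij iI G]]] :=
    lowest_corner m P (fun i => i < I%:Z) ltac:(move=> ? ?; lia) ex.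
  have [i0 j0 Bij _] := cij.
  have Jj : J < j%:Z.
    have [//|le] : J < j%:Z \/ j%:Z <= J by lia.
    by case: Bij; apply: GI; lia.
  have [hd|hl'] := corner_heads _ _ T _ _ cij; last first.
    by apply: (IHn _ _ _ cij hl'); lia.
  have [dc _] := heads_down_config _ _ T _ _ _ cij hd iI
    (fun i' j' hi hj => G i' j' ltac:(lia) ltac:(lia) hj).
  have [//|uc _] := up _ Jj.
    by move=> i' j' hi hj; apply: G => //; lia.
  exact: down_config_flip T _ _ I0 j0 dc uc.
(* With no bad block left of column I, [up] holds for every j above J, against its bound J + m. *)
have [||_] := up (J + m + 1); [by lia | | by lia].
move=> i' j' hi hj; apply: contrapT => B; apply: nex.
exists `|i'|%N, `|j'|%N; have -> : `|i'|%N%:Z = i' by lia.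
have -> : `|j'|%N%:Z = j' by lia.
by split=> //; lia.
Qed.

Lemma all_good m P (T : placement m P) i j :
  0 <= i -> 0 <= j -> good m P i j.
Proof.
move=> i0 j0; apply: contrapT => B; have m2 := pl_ge2 _ _ T.
have [//||i1 [j1 [c _ G]]] := lowest_corner m P (fun=> True).
  exists `|i|%N, `|j|%N; have -> : `|i|%N%:Z = i by lia.
  by have -> : `|j|%N%:Z = j by lia.
have [hd|hl] := corner_heads _ _ T _ _ c; last first.
  exact: heads_left_absurd T _ _ c hl.
(* All lower rows are good, so the column bound may be any number beyond i1; this one exceeds i1 +
   m. *)
have [||_] := heads_down_config _ _ T _ (i1%:Z + m + 1) _ c hd; try lia.
by move=> i' j' hi hj; apply: G => //; lia.
Qed.

(** * From placements back to tilings by sets of cells *)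

Definition shape (n : nat) (k : kind) : set cell :=
  match k with K1 => T1 n | K2 => T2 n | K3 => T3 n | K4 => T4 n | K5 => T5 end.

Lemma translateE (x y u v : int) (A : set cell) :
  translate (x, y) A (u, v) <-> A (u - x, v - y).
Proof.
split=> [[[c d] Acd [<- <-]]|Auv]; first by rewrite !GRing.addrK.
by exists (u - x, v - y) => //; congr pair; rewrite /= GRing.subrK.
Qed.

Lemma hitsP (m n : nat) k x y u v : n = (2 * m)%N ->
  translate (x, y) (shape n k) (u, v) <-> hits m k x y u v.
Proof.
have pairE (a b c d : int) : ((a, b) = (c, d)) = (a = c /\ b = d).
  by apply/propext; split=> [[-> ->]|[-> ->]].
move=> ->; rewrite translateE; case: k;
  rewrite /shape /T1 /T2 /T3 /T4 /T5 /setU /= ?pairE; lia.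
Qed.

(** The least coordinates of a tile are x and y; then five cells near (x, y) tell the kinds apart,
    (x + 2, y) being the one that separates [K1] from [K3]. *)
Lemma hits_inj m k x y k' x' y' : 2 <= m ->
  (forall u v, hits m k x y u v <-> hits m k' x' y' u v) ->
  [/\ k = k', x = x' & y = y'].
Proof.
move=> m2 E.
have ex : x = x'.
  have [y1 h1] : exists y1, hits m k x y x y1.
    by case: k {E}; [exists y|exists (y + 2 * m - 2)|exists y|exists (y + 1)|
      exists y]; rewrite /=; lia.
  have [y2 h2] : exists y2, hits m k' x' y' x' y2.
    by case: k' {E}; [exists y'|exists (y' + 2 * m - 2)|exists y'|
      exists (y' + 1)|exists y']; rewrite /=; lia.
  move/E: h1 => h1; move/E: h2 => h2.
  have : x' <= x by case: k' {E h2} h1 => /=; lia.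
  have : x <= x' by case: k {E h1} h2 => /=; lia.
  lia.
have ey : y = y'.
  have [x1 h1] : exists x1, hits m k x y x1 y.
    by case: k {E}; [exists x|exists (x + 1)|exists x|exists (x + 2 * m - 2)|
      exists x]; rewrite /=; lia.
  have [x2 h2] : exists x2, hits m k' x' y' x2 y'.
    by case: k' {E}; [exists x'|exists (x' + 1)|exists x'|
      exists (x' + 2 * m - 2)|exists x']; rewrite /=; lia.
  move/E: h1 => h1; move/E: h2 => h2.
  have : y' <= y by case: k' {E h2} h1 => /=; lia.
  have : y <= y' by case: k {E h1} h2 => /=; lia.
  lia.
split=> //; subst x' y'.
have := E x (y + 1); have := E (x + 1) y; have := E (x + 1) (y + 1).
have := E x y; have := E (x + 2) y.
by case: k {E}; case: k' => //= *; exfalso; lia.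
Qed.

Lemma placement_of_tiling (m n : nat) tau :
  n = (2 * m)%N -> (2 <= m)%N -> tiling Q1 (ribbonL_plus n) tau ->
  placement m (fun k x y => tau (translate (x, y) (shape n k))).
Proof.
move=> nE m2 [tiles [cov triv _]]; split; first by lia.
- move=> u v u0 v0.
  have : Q1 (u, v) by [].
  rewrite -cov => -[A tA Auv].
  have [T [[x y] [ST AE]]] := tiles _ tA.
  have [k TE] : exists k, T = shape n k.
    by case: ST => [[[[->|->]|->]|->]|->];
      [exists K1|exists K2|exists K3|exists K4|exists K5].
  exists k, x, y; rewrite -TE -AE; split=> //.
  by apply/(hitsP _ _ _ _ _ _ _ nE); rewrite -TE -AE.
- move=> k x y u v tA /(hitsP _ _ _ _ _ _ _ nE) h.
  have : Q1 (u, v) by rewrite -cov; exists (translate (x, y) (shape n k)).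
  by [].
move=> k x y k' x' y' u v tA tB /(hitsP _ _ _ _ _ _ _ nE) h
  /(hitsP _ _ _ _ _ _ _ nE) h'.
have E : translate (x, y) (shape n k) = translate (x', y') (shape n k').
  by apply: triv => //; exists (u, v).
apply: (hits_inj m); first by lia.
by move=> u' v'; rewrite -!(hitsP _ _ _ _ _ _ _ nE) E.
Qed.

Lemma rectangleE x y a b u v :
  rectangle x y a b (u, v) <-> x <= u < x + b%:Z /\ y <= v < y + a%:Z.
Proof. by []. Qed.

Lemma set_cellP (A B : set cell) :
  (forall u v, A (u, v) <-> B (u, v)) -> A = B.
Proof. by move=> E; apply/seteqP; split=> -[u v] /E. Qed.

Lemma ribbonL_shape n k : k <> K5 -> ribbonL n (shape n k).
Proof.
case: k => // _; [by left; left; left|by left; left; right|by left; right|by right].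
Qed.

Lemma tiling_follows_pattern (m n : nat) tau :
  n = (2 * m)%N -> (2 <= m)%N -> tiling Q1 (ribbonL_plus n) tau ->
  follows_rectangular_pattern n tau Q1.
Proof.
move=> nE m2 tl; have T := placement_of_tiling _ _ _ nE m2 tl.
set P := (fun k x y => _) in T.
have hitP k x y u v := hitsP m n k x y u v nE.
pose F : set (set cell) := [set D | exists p q,
  [\/ P K5 (2 * p) (2 * q) /\ D = rectangle (2 * p) (2 * q) 2 2,
      [/\ P K1 (2 * p) (2 * q), P K2 (2 * p) (2 * q + 1) &
          D = rectangle (2 * p) (2 * q) n 2] |
      [/\ P K3 (2 * p) (2 * q), P K4 (2 * p + 1) (2 * q) &
          D = rectangle (2 * p) (2 * q) 2 n]]].
(* Recovers a pattern rectangle from any one of its tiles, so that two rectangles of [F] with a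
   common cell coincide. *)
pose hull k x y := match k with
  | K1 => rectangle x y n 2
  | K2 => rectangle x (y - 1) n 2
  | K3 => rectangle x y 2 n
  | K4 => rectangle (x - 1) y 2 n
  | K5 => rectangle x y 2 2 end.
have tileF D u v : F D -> D (u, v) ->
    exists k x y, [/\ P k x y, hits m k x y u v & D = hull k x y].
  move=> [p [q [[H ->]|[H1 H2 ->]|[H1 H2 ->]]]] /rectangleE h.
  - by exists K5, (2 * p), (2 * q); split=> //=; lia.
  - have [h1|h1] : hits m K1 (2 * p) (2 * q) u v \/
      hits m K2 (2 * p) (2 * q + 1) u v by rewrite /=; lia.
      by exists K1, (2 * p), (2 * q).
    by exists K2, (2 * p), (2 * q + 1); split; rewrite //= GRing.addrK.
  - have [h1|h1] : hits m K3 (2 * p) (2 * q) u v \/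
      hits m K4 (2 * p + 1) (2 * q) u v by rewrite /=; lia.
      by exists K3, (2 * p), (2 * q).
    by exists K4, (2 * p + 1), (2 * q); split; rewrite //= GRing.addrK.
exists F; split; last split.
- move=> D [p [q c]].
  have pair k1 k2 x y x' y' : k1 <> K5 -> k2 <> K5 -> k1 <> k2 ->
      P k1 x y -> P k2 x' y' ->
      (forall u v, D (u, v) <-> hits m k1 x y u v \/ hits m k2 x' y' u v) ->
      two_ribbonL n tau D.
    move=> n1 n2 n12 H1 H2 E.
    exists (translate (x, y) (shape n k1)), (translate (x', y') (shape n k2)).
    split.
    + by split=> //; exists (shape n k1), (x, y); split=> //; apply: ribbonL_shape.
    + by split=> //; exists (shape n k2), (x', y'); split=> //; apply: ribbonL_shape.
    + move=> eT; apply: n12.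
      have [] // := hits_inj m k1 x y k2 x' y'.
      by move=> u v; rewrite -!hitP eT.
    by apply: set_cellP => u v; rewrite E -!hitP.
  case: c => [[H DE]|[H1 H2 DE]|[H1 H2 DE]].
  + exists (2 * p), (2 * q), 2%N, 2%N; split=> //; first by split; lia.
    left; do !split=> //; last exists T5, (2 * p, 2 * q); last split=> //.
      have <- : translate (2 * p, 2 * q) (shape n K5) = D; last by [].
      by apply: set_cellP => u v; rewrite hitP DE rectangleE /=; lia.
    apply: set_cellP => u v; rewrite -/(shape n K5) hitP DE rectangleE /=; lia.
  + exists (2 * p), (2 * q), n, 2%N; split=> //; first by split; lia.
    right; split; [by right|apply: pair H1 H2 _ => // u v].
    by rewrite DE rectangleE /=; lia.
  + exists (2 * p), (2 * q), 2%N, n; split=> //; first by split; lia.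
    right; split; [by left|apply: pair H1 H2 _ => // u v].
    by rewrite DE rectangleE /=; lia.
- apply: set_cellP => u v; split.
    move=> [D FD /= Duv]; have [k [x [y [H h _]]]] := tileF _ _ _ FD Duv.
    exact: pl_inside T _ _ _ _ _ H h.
  move=> [/= u0 v0].
  have [||p [q c]] := all_good _ _ T (u %/ 2)%Z (v %/ 2)%Z; [lia..|].
  case: c => [[H e1 e2]|[H1 H2 e1 e2]|[H1 H2 e1 e2]].
  + exists (rectangle (2 * p) (2 * q) 2 2); first by exists p, q; constructor 1.
    by rewrite /= rectangleE; lia.
  + exists (rectangle (2 * p) (2 * q) n 2); first by exists p, q; constructor 2.
    by rewrite /= rectangleE; lia.
  + exists (rectangle (2 * p) (2 * q) 2 n); first by exists p, q; constructor 3.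
    by rewrite /= rectangleE; lia.
- move=> D D' FD FD' [[u v] [/= h h']].
  have [k [x [y [H hh ->]]]] := tileF _ _ _ FD h.
  have [k' [x' [y' [H' hh' ->]]]] := tileF _ _ _ FD' h'.
  by have [-> -> ->] := pl_disjoint _ _ T _ _ _ _ _ _ _ _ H H' hh hh'.
move=> D [p [q c]]; exists (2 * p, 2 * q).
by case: c => [[_ ->]|[_ _ ->]|[_ _ ->]] /=; rewrite rectangleE; lia.
Qed.

(** * Grids of rectangles with an odd side *)

Lemma translate_rectangle x y a b :
  translate (x, y) (rectangle 0 0 a b) = rectangle x y a b.
Proof.
by apply: set_cellP => u v; rewrite translateE !rectangleE; lia.
Qed.

(** An L contains two diagonal cells of a 2x2 window but not the whole window; the square [T5] would
    force both sides to be 2. *)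
Lemma rectangle_not_shape (m n : nat) x y a b k v :
  n = (2 * m)%N -> (2 <= m)%N -> odd a || odd b ->
  rectangle x y a b <> translate v (shape n k).
Proof.
case: v => z t nE m2 ab E.
have {}E u v : (x <= u < x + b%:Z /\ y <= v < y + a%:Z) <-> hits m k z t u v.
  by rewrite -(hitsP m n) // -E.
case: k E => /= E.
- have := E z (t + 1); have := E (z + 1) t; have := E (z + 1) (t + 1); lia.
- have := E z (t + 2 * m%:Z - 2); have := E (z + 1) (t + 2 * m%:Z - 3).
  have := E z (t + 2 * m%:Z - 3); lia.
- have := E z (t + 1); have := E (z + 1) t; have := E (z + 1) (t + 1); lia.
- have := E (z + 2 * m%:Z - 2) t; have := E (z + 2 * m%:Z - 3) (t + 1).
  have := E (z + 2 * m%:Z - 3) t; lia.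
- have := E z t; have := E (z + 1) (t + 1); have := E (z - 1) t.
  have := E (z + 2) t; have := E z (t - 1); have := E z (t + 2); lia.
Qed.

Lemma eq_of_strip (b p p' : nat) (u : int) :
  b%:Z * p <= u < b%:Z * p + b -> b%:Z * p' <= u < b%:Z * p' + b -> p = p'.
Proof.
move=> h h'; have [lt|lt|//] := ltngtP p p'.
- by have := leq_mul (leqnn b) lt; rewrite mulnS; lia.
- by have := leq_mul (leqnn b) lt; rewrite mulnS; lia.
Qed.

Lemma strip_exists (b : nat) (u : int) : (0 < b)%N -> 0 <= u ->
  exists p : nat, b%:Z * p <= u < b%:Z * p + b.
Proof.
case: u => // k b0 _; exists (k %/ b)%N.
by have := divn_eq k b; have := ltn_pmod k b0; rewrite mulnC; lia.
Qed.

(** The pattern rectangle over (0, 0) would supply a tile that is a copy of some T_k, which no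
    rectangle of the grid is. *)
Lemma grid_tiling_not_pattern (m n : nat) (S : set (set cell)) (a b : nat) :
  n = (2 * m)%N -> (2 <= m)%N -> (0 < a)%N -> (0 < b)%N -> odd a || odd b ->
  exists tau, tiling Q1 (S `|` [set rectangle 0 0 a b]) tau /\
    ~ follows_rectangular_pattern n tau Q1.
Proof.
move=> nE m2 a0 b0 ab.
pose R (p q : nat) := rectangle (b%:Z * p) (a%:Z * q) a b.
exists [set A | exists p q, A = R p q]; split; first split.
- move=> _ [p [q ->]]; exists (rectangle 0 0 a b), (b%:Z * p, a%:Z * q).
  by split; [right|rewrite translate_rectangle].
- split.
  + apply: set_cellP => u v; split.
      move=> [_ [p [q ->]]] /= /rectangleE h; rewrite /Q1 /=.
      by have : 0 <= b%:Z * p by []; have : 0 <= a%:Z * q by []; lia.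
    move=> [/= u0 v0]; have [p hp] := strip_exists _ _ b0 u0.
    have [q hq] := strip_exists _ _ a0 v0.
    by exists (R p q) => //; exists p, q.
  + move=> _ _ [p [q ->]] [p' [q' ->]] [[u v] [/= /rectangleE [h1 h2]]].
    move=> /rectangleE [h1' h2'].
    by rewrite (eq_of_strip _ _ _ _ h1 h1') (eq_of_strip _ _ _ _ h2 h2').
  + move=> _ [p [q ->]]; exists (b%:Z * p, a%:Z * q) => /=.
    by rewrite /R rectangleE; lia.
move=> [F [pat [cov _ _]]].
have : Q1 (0, 0) by [].
rewrite -cov => -[D FD _].
have notR v k p q : R p q <> translate v (shape n k).
  exact: rectangle_not_shape nE m2 ab.
have [x [y [c [d [_ _ [[_ [_ [[p [q DE]] [T [v [TE DT]]]]]]|]]]]]] := pat _ FD.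
  by apply: (notR v K5 p q); rewrite -DE DT TE.
move=> [_ [A [B [[[p [q AE]] [T [v [ST AT]]]] _ _ _]]]].
by case: ST => [[[TE|TE]|TE]|TE];
  [apply: (notR v K1 p q)|apply: (notR v K2 p q)|apply: (notR v K3 p q)|
   apply: (notR v K4 p q)]; rewrite -AE AT TE.
Qed.

Theorem theorem1 (n : nat) (n_ge4 : (4 <= n)%N) (n_even : ~~ odd n) :
  ((forall tau, tiling Q1 (ribbonL_plus n) tau ->
      follows_rectangular_pattern n tau Q1) /\
   (forall tau, tiling Q1 (ribbonL n) tau ->
      follows_rectangular_pattern n tau Q1)) /\
  (forall a b : nat, (0 < a)%N -> (0 < b)%N -> odd a || odd b ->
     (exists tau,
        tiling Q1 (ribbonL_plus n `|` [set rectangle 0%R 0%R a b]) tau /\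
        ~ follows_rectangular_pattern n tau Q1) /\
     (exists tau,
        tiling Q1 (ribbonL n `|` [set rectangle 0%R 0%R a b]) tau /\
        ~ follows_rectangular_pattern n tau Q1)).
Proof.
have nE : n = (2 * n./2)%N by lia.
have m2 : (2 <= n./2)%N by lia.
split; last first.
  by move=> a b a0 b0 ab; split; apply: grid_tiling_not_pattern nE m2 a0 b0 ab.
split=> tau; first exact: tiling_follows_pattern nE m2.
(* A tiling without squares is in particular a tiling by [ribbonL_plus n]. *)
move=> [tiles part]; apply: (tiling_follows_pattern _ _ _ nE m2); split=> // A tA.
by have [T [v [ST AE]]] := tiles _ tA; exists T, v; split=> //; left.
Qed.
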